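(* Consider the two-stage linear adaptive robust optimization problem (P) described in the context, and let $\mathcal{X}\subseteq\mathbb{R}^{n_x}$ be its set of adaptive robustly feasible Stage-1 decisions. If $\mathcal{X}$ is compact, then there exists a Stage-2 decision rule $\bm{y}(\cdot)$ that is Pareto Adaptive Robustly Optimal (PARO) to (P) and such that $\bm{y}(\bm{z})$ is piecewise linear in $\bm{z}$ (for $\bm{z}\in U$).
   Context: Problem (P): $\min_{\bm{x},\bm{y}(\cdot)}\max_{\bm{z}\in U}\ \bm{c}(\bm{z})^{\top}\bm{x}+\bm{d}^{\top}\bm{y}(\bm{z})$ subject to $\bm{A}(\bm{z})\bm{x}+\bm{B}\bm{y}(\bm{z})\le \bm{r}(\bm{z})$ for all $\bm{z}\in U$. Here $U\subseteq\mathbb{R}^L$ is compact and convex with nonempty relative interior; $\bm{x}\in\mathbb{R}^{n_x}$ (Stage-1 decision); $\bm{y}\in\mathcal{R}^{L,n_y}$ (Stage-2 decision rule), where $\mathcal{R}^{L,n_y}$ is the set of measurable functions $\mathbb{R}^L\to\mathbb{R}^{n_y}$ that are bounded on compact sets; $\bm{B}\in\mathbb{R}^{m\times n_y}$ and $\bm{d}\in\mathbb{R}^{n_y}$ are constant; $\bm{A}(\bm{z})\in\mathbb{R}^{m\times n_x}$, $\bm{r}(\bm{z})\in\mathbb{R}^m$, $\bm{c}(\bm{z})\in\mathbb{R}^{n_x}$ depend affinely on $\bm{z}$. A pair $(\bm{x},\bm{y}(\cdot))$ is adaptive robustly feasible (ARF) if it satisfies all constraints of (P); $\bm{x}$ is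 ARF if some $\bm{y}(\cdot)\in\mathcal{R}^{L,n_y}$ makes $(\bm{x},\bm{y}(\cdot))$ ARF, and $\mathcal{X}$ is the set of ARF $\bm{x}$. $\mathrm{OPT}$ is the optimal (worst-case) value of (P). Standing assumptions: $\mathcal{X}\ne\emptyset$ and $\mathrm{OPT}$ is finite. A pair is adaptive robustly optimal (ARO) if it is ARF and $\bm{c}(\bm{z})^{\top}\bm{x}+\bm{d}^{\top}\bm{y}(\bm{z})\le\mathrm{OPT}$ for all $\bm{z}\in U$. A pair $(\bm{x},\bm{y}(\cdot))$ is PARO if it is ARO and there is no ARO pair $(\bar{\bm{x}},\bar{\bm{y}}(\cdot))$ with $\bm{c}(\bm{z})^{\top}\bar{\bm{x}}+\bm{d}^{\top}\bar{\bm{y}}(\bm{z})\le \bm{c}(\bm{z})^{\top}\bm{x}+\bm{d}^{\top}\bm{y}(\bm{z})$ for all $\bm{z}\in U$ and with strict inequality for some $\bar{\bm{z}}\in U$. A Stage-2 decision rule $\bm{y}(\cdot)$ is PARO if there exists $\bm{x}$ such that $(\bm{x},\bm{y}(\cdot))$ is PARO. Piecewise linear in $\bm{z}$ means: $U$ can be partitioned into finitely many subsets, each cut out of $U$ by finitely many (weak or strict) affine inequalities in $\bm{z}$, such that on each subset $\bm{y}$ coincides with an affine function of $\bm{z}$. *)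

(* Defs.v *)
From mathcomp Require Import all_boot all_order all_algebra.
From mathcomp Require Import all_classical all_reals all_analysis.

Set Implicit Arguments.
Unset Strict Implicit.
Unset Printing Implicit Defensive.

Import Order.TTheory GRing.Theory Num.Theory.
Import numFieldNormedType.Exports.

Local Open Scope classical_set_scope.
Local Open Scope ring_scope.

Definition dotv (R : realType) (n : nat) (u v : 'cV[R]_n) : R :=
  (u^T *m v) 0 0.

Definition lev (R : realType) (n : nat) (u v : 'cV[R]_n) : Prop :=
  forall i, u i 0 <= v i 0.

Definition affine_map (R : realType) (V W : lmodType R) (f : V -> W) : Prop :=
  exists (g : {linear V -> W}) (w : W), forall v, f v = g v + w.

Definition affine_hull (R : realType) (V : lmodType R) (A : set V) : set V :=
  [set v | exists (k : nat) (t : 'I_k -> R) (p : 'I_k -> V),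
     [/\ forall i, A (p i), \sum_i t i = 1 & v = \sum_i t i *: p i]].

Definition relative_interior (R : realType) (V : normedModType R) (A : set V) :
    set V :=
  [set v | A v /\ \forall w \near v, affine_hull A w -> A w].

(* R^n with its Borel sigma-algebra. *)
Definition borelV (R : realType) (n : nat) :=
  g_sigma_algebraType (@open 'cV[R]_n).

Definition decision_rule (R : realType) (L n : nat)
    (y : 'cV[R]_L -> 'cV[R]_n) : Prop :=
  measurable_fun [set: borelV R L] (y : borelV R L -> borelV R n) /\
  forall K : set 'cV[R]_L, compact K -> bounded_set (y @` K).

Record affine_ineq (R : realType) (L : nat) := AffineIneq {
  weak : bool;
  normal : 'cV[R]_L;
  bound : R }.

Definition satisfies (R : realType) (L : nat) (z : 'cV[R]_L)
    (h : affine_ineq R L) : bool :=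
  dotv (normal h) z < bound h ?<= if weak h.

Definition cut_out (R : realType) (L : nat) (U S : set 'cV[R]_L) : Prop :=
  exists s : seq (affine_ineq R L), S = U `&` [set z | all (satisfies z) s].

Definition piecewise_linear (R : realType) (L n : nat) (U : set 'cV[R]_L)
    (y : 'cV[R]_L -> 'cV[R]_n) : Prop :=
  exists (k : nat) (S : 'I_k -> set 'cV[R]_L),
    [/\ partition [set: 'I_k] S U,
        forall i, cut_out U (S i)
      & forall i, exists f : 'cV[R]_L -> 'cV[R]_n,
          affine_map f /\ forall z, S i z -> y z = f z].

(* Data of the two-stage problem
     min_(x, y(.)) max_(z in U)  c(z)^T x + d^T y(z)
     s.t.  A(z) x + B y(z) <= r(z)  for all z in U. *)
Record two_stage (R : realType) (L nx ny m : nat) := TwoStage {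
  unc : set 'cV[R]_L;
  tech : 'cV[R]_L -> 'M[R]_(m, nx);
  recourse : 'M[R]_(m, ny);
  rhs : 'cV[R]_L -> 'cV[R]_m;
  cost1 : 'cV[R]_L -> 'cV[R]_nx;
  cost2 : 'cV[R]_ny }.

Section TwoStageTheory.
Context (R : realType) (L nx ny m : nat) (P : two_stage R L nx ny m).
Implicit Types (x : 'cV[R]_nx) (y : 'cV[R]_L -> 'cV[R]_ny) (z : 'cV[R]_L).

Definition cost x y z : R := dotv (cost1 P z) x + dotv (cost2 P) (y z).

Definition ARF x y : Prop :=
  decision_rule y /\
  forall z, unc P z -> lev (tech P z *m x + recourse P *m y z) (rhs P z).

Definition ARF_stage1 : set 'cV[R]_nx := [set x | exists y, ARF x y].

(* A supremum, since a measurable rule need not attain a maximum over U. *)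
Definition worst_case x y : \bar R :=
  ereal_sup [set (cost x y z)%:E | z in unc P].

Definition OPT : \bar R :=
  ereal_inf [set v | exists x y, ARF x y /\ v = worst_case x y].

Definition ARO x y : Prop :=
  ARF x y /\ forall z, unc P z -> ((cost x y z)%:E <= OPT)%E.

Definition PARO x y : Prop :=
  ARO x y /\
  ~ exists x' y',
      [/\ ARO x' y',
          forall z, unc P z -> cost x' y' z <= cost x y z
        & exists z, unc P z /\ cost x' y' z < cost x y z].

Definition PARO_stage2 y : Prop := exists x, PARO x y.

End TwoStageTheory.

(* Main.v *)
(* The linear program  min d^T v  s.t.  B v <= b  has a constant matrix B, so for
   every feasible b it is solved by one of finitely many basic solutions, each
   linear in b, and which one is decided by the signs of finitely many linear
   forms in b.  Substituting b = r(z) - A(z) x, every x has a cost-minimal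
   Stage-2 rule that is piecewise linear in z; let value x z be its cost.  For
   fixed z and q the set {x | value x z <= q} is a finite union of closed
   polyhedra.  By compactness of X, some x satisfies value x z <= OPT for all z,
   and, by Zorn's lemma, some such x is minimal for the pointwise order of
   value x.  This x together with its minimizing rule is PARO.  *)

Require Import Defs.
From HB Require Import structures.
From mathcomp Require Import all_boot all_order all_algebra.
From mathcomp Require Import all_classical all_reals all_analysis.
From mathcomp Require Import lra.
Import Order.TTheory GRing.Theory Num.Theory.
Import numFieldNormedType.Exports.
Local Open Scope classical_set_scope.
Local Open Scope ring_scope.

Set Implicit Arguments.
Unset Strict Implicit.
Unset Printing Implicit Defensive.

(** * Linearity of the inner product *)

Lemma dotvDr (R : realType) n (u v w : 'cV[R]_n) :
  dotv u (v + w) = dotv u v + dotv u w.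
Proof. by rewrite /dotv mulmxDr mxE. Qed.

Lemma dotvZr (R : realType) n (u v : 'cV[R]_n) (a : R) :
  dotv u (a *: v) = a * dotv u v.
Proof. by rewrite /dotv -scalemxAr mxE. Qed.

Lemma dotvNr (R : realType) n (u v : 'cV[R]_n) : dotv u (- v) = - dotv u v.
Proof. by rewrite /dotv mulmxN mxE. Qed.

Lemma dotvNl (R : realType) n (u v : 'cV[R]_n) : dotv (- u) v = - dotv u v.
Proof. by rewrite /dotv linearN mulNmx mxE. Qed.

(** * Linear programs with a fixed matrix and a varying right-hand side *)

Section LinearProgram.
Context (R : realType) (m n : nat) (B : 'M[R]_(m, n)) (d : 'cV[R]_n).
Implicit Types (y v : 'cV[R]_n) (b : 'cV[R]_m) (I : {set 'I_m}).

(** Rows outside [I] are zeroed, not deleted, so that the matrix size does not depend on [I]. *)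
Definition restrict_rows I : 'M[R]_m := diag_mx (\row_i (i \in I)%:R).

Lemma restrict_rowsE I (u : 'cV[R]_m) i :
  (restrict_rows I *m u) i 0 = (i \in I)%:R * u i 0.
Proof. by rewrite mul_diag_mx !mxE. Qed.

(* A linear solution of the equations indexed by I, whenever they are solvable. *)
Definition basic_solution I : 'M[R]_(n, m) :=
  pinvmx (restrict_rows I *m B) *m restrict_rows I.

Definition tight b y : {set 'I_m} := [set i | (B *m y) i 0 == b i 0].

Hypothesis no_ray : forall v, lev (B *m v) 0 -> 0 <= dotv d v.

(* Moving along v until the first row with (B v)_j > 0 blocks. *)
Lemma blocked_line b y v j : lev (B *m y) b -> 0 < (B *m v) j 0 ->
  (forall i, i \in tight b y -> (B *m v) i 0 = 0) ->
  exists2 t, 0 <= t &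
    lev (B *m (y + t *: v)) b /\ tight b y \proper tight b (y + t *: v).
Proof.
move=> yb vj vI.
pose ratio i := (b i 0 - (B *m y) i 0) / (B *m v) i 0.
have [k vk kmin] := arg_minP (P := fun i => 0 < (B *m v) i 0) ratio vj.
have lineE i t : (B *m (y + t *: v)) i 0 = (B *m y) i 0 + t * (B *m v) i 0.
  by rewrite mulmxDr -scalemxAr !mxE.
have t0 : 0 <= ratio k by rewrite divr_ge0 ?subr_ge0 ?yb ?ltW.
exists (ratio k) => //; split=> [i|].
  rewrite lineE -lerBrDl; have [vi|vi] := ltP 0 ((B *m v) i 0).
    by rewrite -ler_pdivlMr ?kmin.
  by rewrite (@le_trans _ _ 0) ?subr_ge0 ?mulr_ge0_le0 ?yb.
apply/properP; split.
  apply/fintype.subsetP => i iI; rewrite inE lineE vI // mulr0 addr0.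
  by move: iI; rewrite inE.
exists k; last by apply/negP => /vI vk0; rewrite vk0 ltxx in vk.
by rewrite inE lineE /ratio divfK ?(gt_eqF vk) // addrC subrK.
Qed.

(** The basic solution solves the tight equations, as [y] does, so the difference lies in the kernel
    that the hypothesis controls. *)
Lemma basic_solution_tight b y :
  (forall v, (forall i, i \in tight b y -> (B *m v) i 0 = 0) ->
     B *m v = 0 /\ dotv d v = 0) ->
  let w := basic_solution (tight b y) *m b in
  B *m w = B *m y /\ dotv d w = dotv d y.
Proof.
move=> ker /=; set I := tight b y; set w := _ *m b.
set C := restrict_rows I *m B.
have bI : restrict_rows I *m b = C *m y.
  apply/colP => i; rewrite /C -mulmxA !restrict_rowsE.
  by have [|] := boolP (i \in I); rewrite ?mul0r // inE => /eqP->.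
(* Since the restricted [b] is [C *m y], this is the pseudo-inverse identity
   [C *m pinvmx C *m C = C] applied to [y]. *)
have Cw : C *m (w - y) = 0.
  rewrite mulmxBr /w /basic_solution -/C -(mulmxA (pinvmx C)) bI.
  by rewrite (mulmxA C (pinvmx C)) (mulmxA (C *m pinvmx C)) mulmxKpV ?subrr.
have [Bwy dwy] : B *m (w - y) = 0 /\ dotv d (w - y) = 0.
  apply: ker => i iI; move/colP/(_ i): Cw.
  by rewrite /C -mulmxA restrict_rowsE iI mul1r [X in _ = X -> _]mxE.
split; apply/eqP; rewrite -subr_eq0.
  by rewrite -mulmxBr Bwy.
by rewrite -dotvNr -dotvDr dwy.
Qed.

(** Induction on the number of rows that are not tight: each move along a blocked line makes a
    further row tight. *)
Lemma basic_solution_dominates b y : lev (B *m y) b ->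
  exists I, lev (B *m (basic_solution I *m b)) b /\
    dotv d (basic_solution I *m b) <= dotv d y.
Proof.
have [k] := ubnP #|~: tight b y|; elim: k y => // k IHk y yk yb.
(* Enlarge the tight set until every direction in the kernel of the tight rows
   changes neither the constraints nor the cost. *)
have [[v [vI dv [j vj]]]|nov] := pselect (exists v,
    [/\ forall i, i \in tight b y -> (B *m v) i 0 = 0, dotv d v <= 0
      & exists j, 0 < (B *m v) j 0]).
  have [t t0 [tb tI]] := blocked_line yb vj vI.
  have [||I [Ib Id]] := IHk (y + t *: v) => //.
    by rewrite -ltnS (leq_trans _ yk) // ltnS proper_card // properC.
  exists I; split=> //; apply: (le_trans Id).
  by rewrite dotvDr dotvZr gerDl mulr_ge0_le0.
(* A kernel direction that does not raise the cost is now a recession direction, so [no_ray] makes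
   its cost 0. Used for both [v] and [- v], this yields [B *m v = 0]. *)
have nonpos v : (forall i, i \in tight b y -> (B *m v) i 0 = 0) ->
    dotv d v <= 0 -> lev (B *m v) 0.
  move=> vI dv i; rewrite [X in _ <= X]mxE leNgt; apply/negP => vi.
  by apply: nov; exists v; split=> //; exists i.
have cost0 v : (forall i, i \in tight b y -> (B *m v) i 0 = 0) ->
    dotv d v <= 0 -> dotv d v = 0.
  by move=> vI dv; apply/le_anti; rewrite dv no_ray //; exact: nonpos.
have oppI v : (forall i, i \in tight b y -> (B *m v) i 0 = 0) ->
    forall i, i \in tight b y -> (B *m - v) i 0 = 0.
  by move=> vI i iI; rewrite mulmxN [LHS]mxE vI ?oppr0.
exists (tight b y); have [|-> ->] := @basic_solution_tight b y => // v vI.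
have dv : dotv d v = 0.
  have [/cost0->//|/ltW dv] := leP (dotv d v) 0.
  by apply/oppr_inj; rewrite oppr0 -dotvNr cost0 ?dotvNr ?oppr_le0 //; exact: oppI.
split=> //; apply/colP => i; apply/le_anti.
rewrite nonpos ?dv //=.
have := @nonpos (- v) (oppI _ vI); rewrite dotvNr dv oppr0 => /(_ (lexx _) i).
rewrite mulmxN [X in X <= _]mxE [X in _ <= X]mxE oppr_le0 => vi.
by rewrite [X in X <= _]mxE.
Qed.

(* The signs of these linear forms decide which basic solutions are feasible
   (left summand) and how their costs compare (right summand). *)
Definition test_index : finType :=
  ({set 'I_m} * 'I_m + {set 'I_m} * {set 'I_m})%type.

Definition test (k : test_index) : 'rV[R]_m :=
  match k with
  | inl Ii => row Ii.2 (B *m basic_solution Ii.1 - 1%:M)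
  | inr IJ => d^T *m (basic_solution IJ.1 - basic_solution IJ.2)
  end.

Definition tests b : {set test_index} := [set k | (test k *m b) 0 0 <= 0].

(** Stated for a set [p] of passed tests instead of [b], so that the basic solution chosen from [p]
    is constant wherever the tests agree. *)
Definition feasible_in (p : {set test_index}) I := [forall i, inl (I, i) \in p].

Definition optimal_in (p : {set test_index}) I :=
  feasible_in p I && [forall J, feasible_in p J ==> (inr (I, J) \in p)].

(** For [p = tests b], under [no_ray], the default 0 is reached only if the program for [b] is
    infeasible. *)
Definition lp_map (p : {set test_index}) : 'M[R]_(n, m) :=
  if [pick I | optimal_in p I] is Some J then basic_solution J else 0.

Definition lp_solution b : 'cV[R]_n := lp_map (tests b) *m b.

Lemma feasible_inP b I :
  reflect (lev (B *m (basic_solution I *m b)) b) (feasible_in (tests b) I).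
Proof.
have mem_inl i : (inl (I, i) \in tests b) =
    ((B *m (basic_solution I *m b)) i 0 <= b i 0).
  rewrite inE /= -row_mul [X in X <= _]mxE mulmxBl mul1mx -mulmxA.
  by rewrite -[RHS]subr_le0; congr (_ <= 0); rewrite [LHS]mxE [X in _ + X]mxE.
by apply: (iffP forallP) => /= Ib i; have := Ib i; rewrite mem_inl.
Qed.

Lemma mem_inr_tests b I J : (inr (I, J) \in tests b) =
  (dotv d (basic_solution I *m b) <= dotv d (basic_solution J *m b)).
Proof.
rewrite inE /= -mulmxA mulmxBl mulmxBr -[RHS]subr_le0.
by congr (_ <= 0); rewrite [LHS]mxE [X in _ + X]mxE.
Qed.

(** Some feasible basic solution is cheapest, so [pick] succeeds; its choice beats all feasible
    basic solutions and, through them, every feasible point. *)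
Lemma lp_solutionP b y : lev (B *m y) b ->
  lev (B *m lp_solution b) b /\ dotv d (lp_solution b) <= dotv d y.
Proof.
move=> yb; have [I0 [/feasible_inP I0b _]] := basic_solution_dominates yb.
pose f I := dotv d (basic_solution I *m b).
have [I Ib Imin] := arg_minP (P := feasible_in (tests b)) f I0b.
rewrite /lp_solution /lp_map.
case: pickP => [J /andP[/feasible_inP Jb /forallP Jmin]|].
  split=> //; have [J' [/feasible_inP J'b]] := basic_solution_dominates yb.
  by apply: le_trans; have := Jmin J'; rewrite J'b mem_inr_tests.
move=> /(_ I); rewrite /optimal_in Ib /= => /negP[]; apply/forallP => J.
by apply/implyP => Jb; rewrite mem_inr_tests; exact: Imin.
Qed.

End LinearProgram.

(** * Minimal elements of preorders on compact sets *)

Section CompactMinimality.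
Context (T : ptopologicalType) (K : set T).
Hypothesis K_compact : compact K.

Definition relatively_closed (C : set T) :=
  exists2 G, closed G & C = K `&` G.

(** Finite intersection property: finitely many members of a chain contain a common nonempty
    member. *)
Lemma chain_meet (I : choiceType) (D : set I) (C : I -> set T) :
  D !=set0 ->
  (forall i, D i -> relatively_closed (C i) /\ C i !=set0) ->
  (forall i j, D i -> D j -> C i `<=` C j \/ C j `<=` C i) ->
  \bigcap_(i in D) C i !=set0.
Proof.
move=> [i0 Di0] DC Ctot.
have sub_all (s : seq I) : {in s, forall i, D i} ->
    exists2 i, D i & {in s, forall j, C i `<=` C j}.
  elim: s => [|j s IHs] sD; first by exists i0.
  have Dj : D j by apply: sD; rewrite inE eqxx.
  have [|i Di iP] := IHs; first by move=> i si; apply: sD; rewrite inE si orbT.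
  have [ij|ji] := Ctot _ _ Di Dj.
    by exists i => // l; rewrite inE => /predU1P[->//|]; exact: iP.
  exists j => // l; rewrite inE => /predU1P[->//|/iP]; exact: subset_trans.
have [G GP] : {G : I -> set T & forall i, D i -> closed (G i) /\ C i = K `&` G i}.
  apply: (@choice _ _ (fun i G => D i -> closed G /\ C i = K `&` G)) => i.
  have [Di|nDi] := pselect (D i); last by exists setT.
  by have [[G Gcl CE] _] := DC i Di; exists G.
move: K_compact; rewrite compact_In0; apply.
  by exists G => i /GP[].
move=> D' D'D; have [|i Di iP] := sub_all (finmap.enum_fset D').
  by move=> i /D'D; rewrite inE.
by have [_ [x Cx]] := DC i Di; exists x => j jD'; exact: (iP j jD').
Qed.

(** Zorn's lemma. Antisymmetry is not assumed, because distinct Stage-1 decisions may have equal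
    values everywhere. *)
Lemma compact_preorder_minimal (le : T -> T -> Prop) :
  K !=set0 -> (forall x, le x x) ->
  (forall x y z, le x y -> le y z -> le x z) ->
  (forall x, K x -> relatively_closed (K `&` [set y | le y x])) ->
  exists2 x, K x & forall y, K y -> le y x -> le x y.
Proof.
move=> [x0 Kx0] le_refl le_trans le_closed.
(* The order is reversed, as Zorn's lemma yields maximal elements. *)
pose R (x y : {x | K x}) := `[< le (sval y) (sval x) >].
have [] := @ZL_preorder {x | K x} (exist _ x0 Kx0) R.
- by move=> x; exact/asboolP.
- move=> y x z /asboolP xy /asboolP yz; apply/asboolP; exact: le_trans yz xy.
- move=> A Atot; have [[a Aa]|A0] := pselect (A !=set0); last first.
    by exists (exist _ x0 Kx0) => s As; case: A0; exists s.
  (* A common point of the lower sections is a lower bound of the chain. *)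
  have [||| x xP] :=
    @chain_meet T (sval @` A) (fun x => K `&` [set y | le y x]).
  + by exists (sval a), a.
  + move=> _ [[x Kx] _ <-] /=; split; first exact: le_closed.
    by exists x; split.
  + move=> _ _ [x Ax <-] [y Ay <-].
    have [/asboolP xy|/asboolP yx] := Atot _ _ Ax Ay.
      by right=> z [Kz zx]; split=> //; apply: le_trans zx _.
    by left=> z [Kz zx]; split=> //; apply: le_trans zx _.
  have [Kx _] := xP (sval a) (ex_intro2 _ _ a Aa erefl).
  exists (exist _ x Kx) => s As; apply/asboolP.
  by have [] := xP (sval s) (ex_intro2 _ _ s As erefl).
move=> [x Kx] xmin; exists x => // y Ky yx.
by have /asboolP := xmin (exist _ y Ky) (asboolT yx).
Qed.

End CompactMinimality.

(** * Continuity of affine maps *)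

Lemma affine_map_continuous (R : realType) L (V : normedModType R)
  (f : 'cV[R]_L -> V) : affine_map f -> continuous f.
Proof.
move=> [g [w fE]].
have {}fE : f = fun v => \sum_i v i 0 *: g (delta_mx i 0) + w.
  apply/funext => v; rewrite fE {1}[v]matrix_sum_delta linear_sum; congr (_ + _).
  by apply: eq_bigr => i _; rewrite big_ord1 linearZ.
rewrite fE => v.
apply: (@continuousD _ _ _
  (fun v : 'cV[R]_L => \sum_i v i 0 *: g (delta_mx i 0)) (cst w)).
  apply: (@continuous_big _ _ _ _ _ add_continuous) => i _ u.
  apply: continuousZr_tmp; exact: coord_continuous.
exact: cst_continuous.
Qed.

Lemma mulmx_continuous (R : realType) p L (M : 'M[R]_(p, L)) :
  continuous (fun v : 'cV[R]_L => M *m v).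
Proof.
apply: affine_map_continuous.
by exists (mulmx M : {linear 'cV[R]_L -> 'cV[R]_p}), 0 => v; rewrite addr0.
Qed.

Lemma dotv_continuous (R : realType) L (u : 'cV[R]_L) :
  continuous (dotv u : 'cV[R]_L -> R).
Proof.
move=> v; apply: (@continuous_comp _ _ _ (mulmx u^T) (fun M => M 0 0)).
  exact: mulmx_continuous.
exact: coord_continuous.
Qed.

(** * Rules that choose an affine map by the outcomes of finitely many affine tests *)

Section AffinePatterns.
Context (R : realType) (L n : nat) (K : finType).
Context (a : K -> 'cV[R]_L) (c : K -> R) (F : {set K} -> 'cV[R]_L -> 'cV[R]_n).
Hypothesis F_affine : forall p, affine_map (F p).

Definition pattern (z : 'cV[R]_L) : {set K} := [set k | dotv (a k) z <= c k].

Definition patterned (z : 'cV[R]_L) : 'cV[R]_n := F (pattern z) z.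

Lemma piecewise_linear_patterned U : piecewise_linear U patterned.
Proof.
pose cell p := U `&` [set z | pattern z = p].
(* Only patterns that occur in [U] are kept, since the pieces of a partition must be nonempty. *)
pose N := [set p | `[< cell p !=set0 >]]%SET.
exists #|N|, (fun i => cell (enum_val i)); split.
- split.
  + apply/seteqP; split=> [z [i _ []]//|z Uz].
    have Nz : pattern z \in N by rewrite inE; apply/asboolP; exists z.
    exists (enum_rank_in Nz (pattern z)) => //; split=> //=.
    by rewrite enum_rankK_in.
  + by move=> i j _ _ [z [[_ /= iz] [_ /= jz]]]; apply: enum_val_inj; rewrite -iz.
  + by move=> i _; have := enum_valP i; rewrite inE => /asboolP.
- move=> i; set p := enum_val i.
  exists [seq (if k \in p then AffineIneq true (a k) (c k)
               else AffineIneq false (- a k) (- c k)) | k <- enum K].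
  congr (_ `&` _); apply/seteqP; split=> z /=; rewrite all_map.
    move=> <-; apply/allP => k _; rewrite /= /satisfies inE.
    by case: leP => //= kz; rewrite dotvNl ltrN2.
  move=> /allP zP; apply/setP => k; rewrite inE.
  have /zP : k \in enum K by rewrite mem_enum.
  rewrite /= /satisfies; case: (k \in p) => //=.
  by rewrite dotvNl ltrN2 leNgt => ->.
- by move=> i; exists (F (enum_val i)); split=> // z [_ /= <-].
Qed.

(** Preimages of open sets are finite unions of Borel cells cut with open sets; the image of a
    compact set lies in a finite union of compact images. *)
Lemma decision_rule_patterned : decision_rule patterned.
Proof.
split.
  have open_meas (A : set 'cV[R]_L) : open A ->
      measurable (A : set (borelV R L)) by exact: sub_sigma_algebra.
  have half_meas k : measurable ([set z | dotv (a k) z <= c k] : set (borelV R L)).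
    have /continuous_closedP := @dotv_continuous R L (a k).
    move=> /(_ _ (closed_le (y := c k)))/closed_openC/open_meas Hm; rewrite -[X in measurable X]setCK.
    exact: (@measurableC _ (borelV R L)).
  have cell_meas p : measurable ([set z | pattern z = p] : set (borelV R L)).
    rewrite [X in measurable X](_ : _ = \bigcap_(k in [set: K])
      if k \in p then [set z | dotv (a k) z <= c k]
      else ~` [set z | dotv (a k) z <= c k]).
      apply: fin_bigcap_measurable => // k _.
      by case: ifP => _; [exact: half_meas|apply: measurableC; exact: half_meas].
    apply/seteqP; split=> z /=.
      by move=> <- k _; rewrite inE; case: ifPn => //= /negP.
    move=> zP; apply/setP => k; rewrite inE; have := zP k I.
    by case: ifP => //= _ /negP/negbTE.
  apply: (@measurability _ _ (borelV R L) (borelV R n) setT _ open) => //.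
  move=> _ [A Aopen <-]; rewrite setTI.
  rewrite [X in measurable X](_ : _ = \bigcup_(p in [set: {set K}])
      ([set z | pattern z = p] `&` F p @^-1` A)).
    apply: fin_bigcup_measurable => // p _; apply: measurableI => //.
    apply: open_meas; apply: open_comp => // z _.
    exact: affine_map_continuous.
  apply/seteqP; split=> z /=; first by exists (pattern z).
  by move=> [p _ [/= <-]].
move=> C Ccompact.
have /compact_bounded : compact (\big[setU/set0]_(p : {set K}) (F p @` C)).
  apply: bigsetU_compact => p _; apply: continuous_compact => //.
  exact/continuous_subspaceT/affine_map_continuous.
apply: sub_boundedr => A DA _ [z Cz <-]; apply: DA.
by rewrite (bigD1 (pattern z)) //=; left; exists z.
Qed.

End AffinePatterns.

(** * Matrix form of affine maps, translated rules and closed half-spaces *)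

Lemma affine_map_mulmxP (R : realType) L n (f : 'cV[R]_L -> 'cV[R]_n) :
  affine_map f <-> exists M w, forall v, f v = M *m v + w.
Proof.
split=> [[g [w fE]]|[M [w fE]]].
  exists (\matrix_(i, j) g (delta_mx j 0) i 0), w => v.
  rewrite fE {1}[v]matrix_sum_delta linear_sum; congr (_ + _).
  apply/colP => i; rewrite summxE mxE; apply: eq_bigr => j _.
  by rewrite big_ord1 linearZ !mxE mulrC.
by exists (mulmx M : {linear 'cV[R]_L -> 'cV[R]_n}), w.
Qed.

Lemma affine_mapB_mulmx (R : realType) L n p (f : 'cV[R]_L -> 'cV[R]_p)
    (A : 'cV[R]_L -> 'M[R]_(p, n)) (x : 'cV[R]_n) :
  affine_map f -> affine_map A -> affine_map (fun z => f z - A z *m x).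
Proof.
move=> [g [w fE]] [h [C AE]].
exists (g \- (mulmxr x \o h)), (w - C *m x) => z.
by rewrite fE AE mulmxDl /= opprD addrACA.
Qed.

Lemma decision_rule_shift (R : realType) L n (y : 'cV[R]_L -> 'cV[R]_n) w :
  decision_rule y -> decision_rule (fun z => y z + w).
Proof.
move=> [ym yb]; split.
  apply: (@measurability _ _ (borelV R L) (borelV R n) setT _ open) => //.
  move=> _ [A Aopen <-].
  have shift_open : open [set u | A (u + w)].
    have /continuousP : continuous (fun u : 'cV[R]_n => u + w).
      move=> u; apply: (@continuousD _ _ _ id (cst w)) => //.
      exact: cst_continuous.
    by apply.
  by have := ym measurableT _ (sub_sigma_algebra shift_open).
move=> C /yb [M [Mreal MP]]; exists (M + `|w|); split.
  by rewrite realD ?normr_real.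
move=> N MN _ [z Cz <-] /=.
apply: (le_trans (ler_normD _ _)); rewrite -lerBrDr.
by apply: (MP (N - `|w|)); [rewrite ltrBrDr|exists z].
Qed.

Lemma closed_coord_le (R : realType) L n (M : 'M[R]_(n, L)) (w : 'cV[R]_n) i c :
  closed [set v : 'cV[R]_L | (M *m v + w) i 0 <= c].
Proof.
have f_cont : continuous (fun v : 'cV[R]_L => (M *m v + w) i 0).
  move=> v; apply: (@continuous_comp _ _ _ (fun v => M *m v + w) (fun u => u i 0)).
    by apply: affine_map_continuous; apply/affine_map_mulmxP; exists M, w.
  exact: coord_continuous.
by have /continuous_closedP/(_ _ (closed_le (y := c))) := f_cont.
Qed.

(** * Cost-minimal Stage-2 rules and their values *)

Section TwoStageRules.
Context (R : realType) (L nx ny m : nat) (P : two_stage R L nx ny m).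
Hypothesis A_affine : affine_map (tech P).
Hypothesis r_affine : affine_map (rhs P).
Hypothesis no_ray : forall v, lev (recourse P *m v) 0 -> 0 <= dotv (cost2 P) v.

Local Notation B := (recourse P).
Local Notation d := (cost2 P).

Definition slack x z : 'cV[R]_m := rhs P z - tech P z *m x.

Lemma feasible_slack x (v : 'cV[R]_ny) z :
  lev (tech P z *m x + B *m v) (rhs P z) <-> lev (B *m v) (slack x z).
Proof.
have slackE i : (slack x z) i 0 = rhs P z i 0 - (tech P z *m x) i 0.
  by rewrite /slack [LHS]mxE [X in _ + X]mxE.
split=> vP i; have := vP i; rewrite slackE lerBrDl.
  by rewrite [X in X <= _ -> _]mxE.
by rewrite [X in _ -> X <= _]mxE.
Qed.

Definition second_stage x z := lp_solution B d (slack x z).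

Definition value x z := dotv (cost1 P z) x + dotv d (second_stage x z).

Lemma second_stageP x z v : lev (tech P z *m x + B *m v) (rhs P z) ->
  lev (tech P z *m x + B *m second_stage x z) (rhs P z) /\
  value x z <= dotv (cost1 P z) x + dotv d v.
Proof.
move=> /feasible_slack/(lp_solutionP no_ray)[vb dv].
by split; [exact/feasible_slack|rewrite lerD2l].
Qed.

(** The slack is affine in [z], so each sign test on it is an affine inequality in [z]. *)
Lemma second_stage_patterned x : exists (K : finType) (a : K -> 'cV[R]_L)
    (c : K -> R) (F : {set K} -> 'cV[R]_L -> 'cV[R]_ny),
  (forall p, affine_map (F p)) /\ second_stage x = patterned a c F.
Proof.
have /affine_map_mulmxP[M [w slackE]] : affine_map (slack x).
  exact: affine_mapB_mulmx.
pose a k := (test B d k *m M)^T.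
pose c k := - (test B d k *m w) 0 0.
pose F p z := lp_map B p *m slack x z.
exists (test_index m), a, c, F; split.
  move=> p; apply/affine_map_mulmxP.
  exists (lp_map B p *m M), (lp_map B p *m w) => z.
  by rewrite /F slackE mulmxDr mulmxA.
apply/funext => z; rewrite /patterned /F /second_stage /lp_solution.
congr (lp_map _ _ *m _); apply/setP => k; rewrite !inE /a /c slackE.
rewrite mulmxDr mulmxA [X in (X <= 0) = _]mxE /dotv trmxK.
by rewrite -lerBrDr sub0r.
Qed.

(** At each [z], a feasible [x] qualifies iff some basic solution is feasible and costs at most
    [q z]: a finite union of closed polyhedra in [x]. The bound [q] is arbitrary so as to cover both
    [OPT] and the value of another decision. *)
Lemma relatively_closed_value (q : 'cV[R]_L -> R) :
  relatively_closed (ARF_stage1 P)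
    (ARF_stage1 P `&` [set x | forall z, unc P z -> value x z <= q z]).
Proof.
pose S (J : {set 'I_m}) x z := basic_solution B J *m slack x z.
pose G z J : set 'cV[R]_nx := \bigcap_(i in [set: 'I_m])
    [set x | ((B *m basic_solution B J - 1%:M) *m slack x z) i 0 <= 0] `&`
  [set x | dotv (cost1 P z) x + dotv d (S J x z) <= q z].
exists (\bigcap_(z in unc P) \bigcup_(J in [set: {set 'I_m}]) G z J).
  apply: closed_bigI => z _.
  apply: closed_bigcup => [|J _]; first exact: finite_finset.
  apply: closedI; first apply: closed_bigI => i _.
    set N := B *m _ - _.
    have NE x : N *m slack x z = - (N *m tech P z) *m x + N *m rhs P z.
      by rewrite /slack mulmxBr mulNmx mulmxA addrC.
    rewrite [X in closed X](_ : _ =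
      [set x | (- (N *m tech P z) *m x + N *m rhs P z) i 0 <= 0]).
      exact: closed_coord_le.
    by apply/seteqP; split=> x /=; rewrite NE.
  pose N := d^T *m basic_solution B J.
  rewrite [X in closed X](_ : _ =
    [set x | (((cost1 P z)^T - N *m tech P z) *m x + N *m rhs P z) 0 0 <= q z]).
    exact: closed_coord_le.
  have NE x : dotv (cost1 P z) x + dotv d (S J x z) =
      (((cost1 P z)^T - N *m tech P z) *m x + N *m rhs P z) 0 0.
    rewrite mulmxBl -addrA [RHS]mxE; congr (_ + fun_of_matrix _ 0 0).
    by rewrite /S /slack mulmxA -/N mulmxBr addrC -(mulmxA N).
  by apply/seteqP; split=> x /=; rewrite NE.
have GP x z J : (\bigcap_(i in [set: 'I_m])
    [set x | ((B *m basic_solution B J - 1%:M) *m slack x z) i 0 <= 0]) x <->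
    lev (B *m S J x z) (slack x z).
  split=> [xG i|xS i _].
    have := xG i I; rewrite /= mulmxBl mul1mx -mulmxA.
    by rewrite [X in X <= _]mxE [X in _ + X]mxE subr_le0.
  have := xS i; rewrite /= mulmxBl mul1mx -mulmxA.
  by rewrite [X in _ -> X <= _]mxE [X in _ -> _ + X <= _]mxE subr_le0.
apply/seteqP; split=> x [Xx xP]; split=> // z Uz.
  (* One inclusion takes a basic solution dominating [second_stage]; the other uses the optimality
     of [second_stage]. *)
  have [y [_ /(_ z Uz) yz]] := Xx.
  have [/feasible_slack ssP _] := second_stageP yz.
  have [J [JP dJ]] := basic_solution_dominates no_ray ssP.
  exists J => //; split; first exact/GP.
  by apply: le_trans (xP z Uz); rewrite lerD2l.
have [J _ [/GP JP]] := xP z Uz; apply: le_trans.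
by have /feasible_slack/second_stageP[_] := JP.
Qed.

End TwoStageRules.

(** * Finiteness of the optimal value and existence of a PARO rule *)

(** Otherwise adding a multiple of [v] to a nearly optimal rule would keep it feasible and push its
    worst case below [OPT]. *)
Lemma recourse_no_ray (R : realType) (L nx ny m : nat)
    (P : two_stage R L nx ny m) (v : 'cV[R]_ny) :
  OPT P \is a fin_num -> lev (recourse P *m v) 0 -> 0 <= dotv (cost2 P) v.
Proof.
move=> OPTfin vB; rewrite leNgt; apply/negP => dv.
have : (OPT P < OPT P + 1)%E by rewrite lteDl.
move=> /ereal_inf_lt[_ [x [y [[yr yP] ->]]] yOPT].
(* The shift lowers the cost by 2, taking a rule within 1 of [OPT] to at most [OPT - 1]. *)
pose t := - 2 / dotv (cost2 P) v.
have t0 : 0 <= t by rewrite /t ler_ndivlMr // mul0r oppr_le0.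
have dt : t * dotv (cost2 P) v = - 2 by rewrite divfK ?lt_eqF.
have yt_feas : ARF P x (fun z => y z + t *: v).
  split; first exact: decision_rule_shift.
  move=> z Uz i; apply: le_trans (yP z Uz i).
  rewrite mulmxDr addrA [X in X <= _]mxE gerDl -scalemxAr mxE.
  by rewrite mulr_ge0_le0 //; have := vB i; rewrite [X in _ <= X]mxE.
have : (OPT P <= OPT P - 1)%E.
  apply: (@le_trans _ _ (worst_case P x (fun z => y z + t *: v))).
    by apply: ereal_inf_lbound; exists x, (fun z => y z + t *: v).
  apply: ge_ereal_sup => _ [z Uz <-].
  have : ((cost P x y z)%:E <= OPT P + 1)%E.
    by apply: le_trans (ltW yOPT); apply: ereal_sup_ubound; exists z.
  rewrite -(fineK OPTfin) -?EFinN -!EFinD !lee_fin /cost dotvDr dotvZr dt => zP.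
  by lra.
by rewrite -(fineK OPTfin) -?EFinN -!EFinD lee_fin => ?; lra.
Qed.

Theorem theorem2 (R : realType) (L nx ny m : nat) (P : two_stage R L nx ny m)
    (U_compact : compact (unc P))
    (U_convex : convex_set (unc P))
    (U_relint : relative_interior (unc P) !=set0)
    (A_affine : affine_map (tech P))
    (r_affine : affine_map (rhs P))
    (c_affine : affine_map (cost1 P))
    (X_neq0 : ARF_stage1 P !=set0)
    (OPT_finite : OPT P \is a fin_num)
    (X_compact : compact (ARF_stage1 P)) :
  exists y : 'cV[R]_L -> 'cV[R]_ny,
    PARO_stage2 P y /\ piecewise_linear (unc P) y.
Proof.
have no_ray v := @recourse_no_ray _ _ _ _ _ P v OPT_finite.
have value_closed := relatively_closed_value no_ray.
set X := ARF_stage1 P in X_compact value_closed.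
have value_le x y z : ARF P x y -> unc P z -> value P x z <= cost P x y z.
  by move=> [_ yP] Uz; have [] := second_stageP no_ray (yP z Uz).
pose v0 := fine (OPT P); have OPTE : OPT P = v0%:E by rewrite fineK.
pose Xopt := X `&` [set x | forall z, unc P z -> value P x z <= v0].
have Xopt_compact : compact Xopt.
  rewrite /Xopt; have [G Gcl /= ->] := value_closed (fun=> v0).
  exact: compact_closedI.
have Xopt_neq0 : Xopt !=set0.
  (* The infimum is attained: the sets of decisions within [e] of [OPT] form a chain of nonempty
     relatively closed sets. *)
  have [||| x xP] := chain_meet X_compact (D := [set e : R | 0 < e])
    (C := fun e => X `&` [set x | forall z, unc P z -> value P x z <= v0 + e]).
  - by exists 1; exact: ltr01.
  - move=> e /= e0; split; first exact: value_closed.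
    have : (OPT P < OPT P + e%:E)%E by rewrite lteDl.
    move=> /ereal_inf_lt[_ [x [y [xy ->]]] /ltW yOPT].
    exists x; split; first by exists y.
    move=> z Uz; rewrite -lee_fin (EFinD v0) -OPTE; apply: le_trans yOPT.
    apply: (@le_trans _ _ (cost P x y z)%:E); first by rewrite lee_fin value_le.
    by apply: ereal_sup_ubound; exists z.
  - have sub (e1 e2 : R) : e1 <= e2 ->
        X `&` [set x | forall z, unc P z -> value P x z <= v0 + e1] `<=`
        X `&` [set x | forall z, unc P z -> value P x z <= v0 + e2].
      move=> e12 x [Xx xP]; split=> // z Uz.
      by apply: le_trans (xP z Uz) _; rewrite lerD2l.
    by move=> e1 e2 /= _ _; have [/sub|/ltW/sub] := leP e1 e2; [left|right].
  exists x; split; first by have [] := xP 1 ltr01.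
  move=> z Uz; apply/ler_addgt0Pr => e e0.
  by have [_] := xP e e0; apply.
have [||| x [Xx xopt] xmin] := compact_preorder_minimal Xopt_compact
  (le := fun x' x => forall z, unc P z -> value P x' z <= value P x z) Xopt_neq0.
- by [].
- by move=> x y z xy yz u Uu; apply: le_trans (xy u Uu) (yz u Uu).
- move=> x _; have [G Gcl GE] := value_closed (value P x).
  by exists G => //; rewrite /Xopt setIAC GE setIAC.
have [K [a [c [F [F_affine ruleE]]]]] :=
  second_stage_patterned A_affine r_affine x.
exists (second_stage P x); split; last first.
  by rewrite ruleE; exact: piecewise_linear_patterned.
exists x; split.
  split; last by move=> z Uz; rewrite OPTE lee_fin; exact: xopt.
  split; first by rewrite ruleE; exact: decision_rule_patterned.
  move=> z Uz; have [y [_ /(_ z Uz)]] := Xx.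
  by move=> /(second_stageP no_ray)[].
(* A dominating pair has [value P x'] below [value P x] everywhere on [U] and strictly at [z],
   against the minimality of [x]. *)
move=> [x' [y' [[ARF' opt'] le' [z [Uz lt']]]]].
have le_x u : unc P u -> value P x' u <= value P x u.
  by move=> Uu; apply: le_trans (value_le _ _ _ ARF' Uu) (le' u Uu).
have Xx' : Xopt x'.
  split; first by exists y'.
  by move=> u Uu; apply: le_trans (le_x u Uu) (xopt u Uu).
have := le_lt_trans (value_le _ _ _ ARF' Uz) lt'.
by rewrite ltNge [_ <= _](xmin x' Xx' le_x).
Qed.
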